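(* Let $\mathfrak A\subseteq\mathbb{R}^{\nu\times\nu}$ and $\mathfrak B\subseteq\mathbb{R}^{\ell\times\ell}$ be (nonunital) operator systems and let $\tau:\mathfrak A\to\mathfrak B$ be a linear $*$-map. Assume $\mathfrak A_{\succeq0}\ne\{0\}$, and let $A_0,\dots,A_{s-1},A_s,\dots,A_g$ be a basis of $\mathfrak A$ such that $A_0,\dots,A_{s-1}$ are symmetric, $A_s,\dots,A_g$ are skew-symmetric, $A_0\neq 0$ is a positive semidefinite matrix of maximum rank among the positive semidefinite elements of $\mathfrak A$, and $A_0,\dots,A_{s-1}$ are pairwise orthogonal, i.e. $\mathrm{Tr}(A_i^*A_j)=0$ for $i\ne j$. Define the linear pencils $$L_{\mathfrak A}(x)=A_0+\sum_{i=1}^{s-1}A_i(x_i+x_i^* )+\sum_{i=s}^gA_i(x_i-x_i^* ),$$ $$L_{\mathfrak B}(x)=\tau(A_0)+\sum_{i=1}^{s-1}\tau(A_i)(x_i+x_i^* )+\sum_{i=s}^g\tau(A_i)(x_i-x_i^* ).$$ Then the following are equivalent: (i) $\tau$ is completely positive; (ii) $\mathcal D_{L_{\mathfrak A}}\subseteq\mathcal D_{L_{\mathfrak B}}$; (iii) $\mathcal D_{L_{\mathfrak A}}(\ell)\subseteq\mathcal D_{L_{\mathfrak B}}(\ell)$.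
   Context: A (nonunital) operator system is a linear subspace of $\mathbb{R}^{\nu\times\nu}$ closed under transpose $A\mapsto A^*$ (not required to contain the identity). $\mathfrak A_{\succeq0}$ is the set of symmetric positive semidefinite elements of $\mathfrak A$. A linear $*$-map $\tau$ is a linear map with $\tau(A^* )=\tau(A)^*$. $\tau$ is positive if $0\preceq A\in\mathfrak A$ implies $\tau(A)\succeq0$, and completely positive if for every $k\in\mathbb{N}$ the ampliation $M_k(\mathfrak A)\to M_k(\mathfrak B)$ applying $\tau$ entrywise to block matrices is positive. Here $x_i,x_i^*$ are free noncommuting letters. For a pencil $L$ with constant coefficient $B_0$ and coefficients $B_i$ of $x_i$, $C_i$ of $x_i^*$, and a tuple $X=(X_1,\dots,X_g)$ of real $n\times n$ matrices, $L(X)=B_0\otimes\mathrm{Id}_n+\sum_i(B_i\otimes X_i+C_i\otimes X_i^* )$ with $X_i^*$ the transpose and $\otimes$ the Kronecker product. $\mathcal D_L(n)=\{X\in(\mathbb{R}^{n\times n})^g:L(X)\succeq0\}$ and $\mathcal D_L=\bigcup_n\mathcal D_L(n)$; inclusion of $\mathcal D$'s means inclusion for every $n$. *)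

(* Defs.v *)
From mathcomp Require Import all_boot all_order all_algebra.
From mathcomp Require Import mxtens.
From mathcomp Require Import classical_sets reals.

Set Implicit Arguments.
Unset Strict Implicit.
Unset Printing Implicit Defensive.

Import Order.TTheory GRing.Theory Num.Theory.
Local Open Scope ring_scope.
Local Open Scope classical_set_scope.

Definition psd (R : realType) (n : nat) (A : 'M[R]_n) : Prop :=
  A^T = A /\ forall v : 'cV[R]_n, 0 <= (v^T *m A *m v) 0 0.

Definition operator_system (R : realType) (n : nat)
    (S : {vspace 'M[R]_n}) : Prop :=
  forall A : 'M[R]_n, A \in S -> A^T \in S.

Definition psd_part (R : realType) (n : nat) (S : {vspace 'M[R]_n}) :
    set 'M[R]_n :=
  [set A | A \in S /\ psd A].

(* [A'] ranges over the elements of [S] whose underlying matrix is [A^T]: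
   there is exactly one when [S] is an operator system. *)
Definition star_map (R : realType) (m n : nat)
    (S : {vspace 'M[R]_m}) (T : {vspace 'M[R]_n})
    (tau : subvs_of S -> subvs_of T) : Prop :=
  forall A A' : subvs_of S,
    vsval A' = (vsval A)^T -> vsval (tau A') = (vsval (tau A))^T.

(* The real block matrix underlying an element of M_k(S). *)
Definition blocks (R : realType) (n k : nat) (S : {vspace 'M[R]_n})
    (M : 'M[subvs_of S]_k) :=
  \mxblock_(i < k, j < k) vsval (M i j).

Definition completely_positive (R : realType) (m n : nat)
    (S : {vspace 'M[R]_m}) (T : {vspace 'M[R]_n})
    (tau : subvs_of S -> subvs_of T) : Prop :=
  forall (k : nat) (M : 'M[subvs_of S]_k),
    psd (blocks M) -> psd (blocks (map_mx tau M)).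

(* The affine linear pencil B_0 + \sum_i (B_i x_i + C_i x_i^* ) in g free
   letters and their formal adjoints; the letter of index i : 'I_g stands for
   x_(i + 1). *)
Record pencil (R : realType) (d g : nat) := Pencil {
  pconst : 'M[R]_d;
  pcoef : 'I_g -> 'M[R]_d;
  pcoef_star : 'I_g -> 'M[R]_d
}.

Definition peval (R : realType) (d g : nat) (L : pencil R d g)
    (n : nat) (X : 'I_g -> 'M[R]_n) : 'M[R]_(d * n) :=
  tensmx (pconst L) (1%:M : 'M[R]_n)
  + \sum_(i < g) (tensmx (pcoef L i) (X i) + tensmx (pcoef_star L i) (X i)^T).

Definition free_spectrahedron (R : realType) (d g : nat) (L : pencil R d g)
    (n : nat) : set ('I_g -> 'M[R]_n) :=
  [set X | psd (peval L X)].
Arguments free_spectrahedron [R d g] L n _.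

(* A_0 + \sum_(1 <= i < s) A_i (x_i + x_i^* ) + \sum_(s <= i <= g) A_i (x_i - x_i^* ):
   the coefficient of x_i^* is A_i for i < s and - A_i for s <= i, where
   [lift ord0 i : 'I_g.+1] has value i + 1. *)
Definition system_pencil (R : realType) (d g s : nat)
    (A : 'I_g.+1 -> 'M[R]_d) : pencil R d g :=
  {| pconst := A ord0;
     pcoef := fun i => A (lift ord0 i);
     pcoef_star := fun i =>
       if (lift ord0 i < s)%N then A (lift ord0 i) else - A (lift ord0 i) |}.

(* Main.v *)
Require Import Defs.
From mathcomp Require Import all_boot all_order all_algebra.
From mathcomp Require Import mxtens.
From mathcomp Require Import classical_sets reals.

Set Implicit Arguments.
Unset Strict Implicit.
Unset Printing Implicit Defensive.

Import Order.TTheory GRing.Theory Num.Theory.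
Local Open Scope ring_scope.
Local Open Scope classical_set_scope.

(** Write a matrix [Y] over the operator system in coordinates,
    [Y = \sum_c A_c (x) Y_c].  Everything takes place on its quadratic form,
    which at the vector with coordinate matrix [W] equals
    [\sum_c tr (W^T A_c W Y_c^T)]; this is [tensor_form].  Both the block
    matrices that define complete positivity ([qform_mxblock]) and the values
    of the pencils ([qform_sum_tens]) have this form.  The spectrahedron of the
    pencil of [A] corresponds to the coordinate families [Y] whose form is
    nonnegative and for which [Y_0 = 1]: the letter [X_i] only enters through
    [X_i + X_i^T] or [X_i - X_i^T], which is an arbitrary symmetric or
    skew-symmetric matrix ([pencil_point_surj]).  Hence a completely positive
    map respects the inclusion of spectrahedra, and the content of the theorem
    is that positivity of [tau] for [l x l] families with [Y_0 = 1] gives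
    positivity for families [Y] of any size and any [Y_0]
    ([tensor_form_nonneg_of_unital]).

    Reduction of the size: evaluating the form of [\sum_c tau(A_c) (x) Y_c] at
    [W], a matrix with [l] rows, is the same as evaluating the form of
    [\sum_c tau(A_c) (x) (W Y_c W^T)] at the identity
    ([tensor_form_congr]).  The matrices [W Y_c W^T] are [l x l], and this
    compression preserves nonnegativity over [A].  In other words a map into
    [l x l] matrices is completely positive as soon as it is [l]-positive.

    Normalisation of [Y_0]: the matrix [Y_0] is automatically positive
    semidefinite ([leading_coef_psd]).  Compressing [Y] by a vector [v] gives
    the element [S = \sum_c (v^T Y_c v) A_c] with nonnegative form;
    [tr (A_0 S)] is nonnegative as the trace of a product of positive
    semidefinite matrices, and orthogonality of the basis leaves only
    [(v^T Y_0 v) tr (A_0^2)] in it.  So, for [e > 0], [Y_0 + e] is positive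
    definite, hence of the form [Q^T Q] with [Q] invertible ([posdef_gram]), and
    congruence by the inverse of [Q] turns it into the identity.  The hypothesis
    applies to the resulting family; undoing the congruence and letting [e]
    tend to [0] gives the claim. *)

(** * Quadratic forms and Gram factorisations *)

Definition qform (R : pzRingType) (n : nat) (A : 'M[R]_n) (v : 'cV[R]_n) : R :=
  (v^T *m A *m v) 0 0.

Lemma congr_mx_entry (R : pzRingType) (m n : nat) (A : 'M[R]_m)
    (V W : 'M[R]_(m, n)) i j :
  (V^T *m A *m W) i j = ((col i V)^T *m A *m col j W) 0 0.
Proof. by rewrite tr_col -row_mul colE mulmxA -row_mul -colE [RHS]mxE [RHS]mxE. Qed.

Lemma ge0_of_small_perturbation (R : realFieldType) (a b : R) :
  (forall e, 0 < e -> 0 <= a + e * b) -> 0 <= a.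
Proof.
move=> H; apply/ler_addgt0Pr => e e0.
have b1 : 0 < `|b| + 1 by rewrite ltr_wpDl.
apply: le_trans (H (e / (`|b| + 1)) (divr_gt0 e0 b1)) _.
rewrite lerD2l -mulrA ler_piMr ?(ltW e0) //.
rewrite (mulrC _^-1) ler_pdivrMr // mul1r.
by rewrite (le_trans (ler_norm b)) // lerDl.
Qed.

Lemma sqr_norm_mx_gt0 (R : realDomainType) (m n : nat) (A : 'M[R]_(m, n)) :
  A != 0 -> 0 < \tr (A^T *m A).
Proof.
move=> A0.
have -> : \tr (A^T *m A) = \sum_j \sum_i A i j ^+ 2.
  by apply: eq_bigr => j _; rewrite mxE; apply: eq_bigr => i _; rewrite mxE.
have sqA j : 0 <= \sum_i A i j ^+ 2 by apply: sumr_ge0 => i _; rewrite sqr_ge0.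
rewrite lt_def sumr_ge0 ?andbT //; apply: contraNneq A0.
move=> /psumr_eq0P trA; apply/eqP/matrixP => i j; rewrite mxE.
have /psumr_eq0P Aj := trA (fun j _ => sqA j) j isT.
by apply/eqP; rewrite -sqrf_eq0 Aj // => k _; rewrite sqr_ge0.
Qed.

Lemma sqr_norm_col_gt0 (R : realDomainType) (n : nat) (v : 'cV[R]_n) :
  v != 0 -> 0 < (v^T *m v) 0 0.
Proof. by move=> /sqr_norm_mx_gt0; rewrite /mxtrace big_ord1. Qed.

(** Cholesky factorisation, by induction on the size: with [a] the leading entry
    and [b] the rest of the first row, the Schur complement [C - b^T b / a] is
    again positive definite, since its value at [v] is the value of [A] at
    [(- b v / a, v)]. *)
Lemma posdef_gram (R : rcfType) (n : nat) (A : 'M[R]_n) :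
  A^T = A -> (forall v, v != 0 -> 0 < qform A v) ->
  exists2 Q : 'M[R]_n, Q \in unitmx & A = Q^T *m Q.
Proof.
elim: n A => [|n IHn] A symA posA.
  by exists 1%:M; [rewrite unitmx1 | rewrite [A]thinmx0 [RHS]thinmx0].
change 'M[R]_(1 + n) in A.
change (forall v : 'cV_(1 + n), v != 0 -> 0 < qform A v) in posA.
pose a := A 0 0; pose b := ursubmx A; pose C := drsubmx A.
have defA : A = block_mx a%:M b b^T C.
  rewrite -{1}[A]submxK; congr block_mx; last by rewrite /b trmx_ursub symA.
  by rewrite [ulsubmx A]mx11_scalar /a !mxE; congr (A _ _)%:M; apply: val_inj.
have a_gt0 : 0 < a.
  have := posA (delta_mx 0 0); rewrite /qform trmx_delta -rowE -colE !mxE.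
  by apply; apply/eqP => /matrixP/(_ 0 0)/eqP; rewrite !mxE !eqxx oner_eq0.
pose S := C - a^-1 *: (b^T *m b).
have symC : C^T = C by rewrite /C trmx_drsub symA.
have symS : S^T = S by rewrite /S linearB linearZ /= trmx_mul trmxK symC.
have posS v : v != 0 -> 0 < qform S v.
  move=> v0; have := posA (col_mx (- a^-1 *: (b *m v)) v).
  rewrite /qform -[_ *m A *m _]mulmxA defA mul_block_col tr_col_mx.
  rewrite mul_row_col mul_scalar_mx scalerA mulrN divff ?gt_eqF // scaleN1r.
  rewrite addNr mulmx0 add0r -scalemxAr scaleNr.
  have -> : - a^-1 *: (b^T *m (b *m v)) + C *m v = S *m v.
    by rewrite mulmxBl -scalemxAl mulmxA scaleNr addrC.
  by rewrite -mulmxA; apply; rewrite col_mx_eq0 negb_and v0 orbT.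
have [Q' Q'u defS] := IHn S symS posS.
pose r := Num.sqrt a.
have r_gt0 : 0 < r by rewrite sqrtr_gt0.
have rr : r * r = a by rewrite -expr2 sqr_sqrtr ?ltW.
change (exists2 Q : 'M[R]_(1 + n), Q \in unitmx & A = Q^T *m Q).
exists (block_mx r%:M (r^-1 *: b) 0 Q').
  rewrite unitmxE det_ublock det_scalar1 unitrM -unitmxE Q'u andbT.
  by rewrite unitfE gt_eqF.
rewrite tr_block_mx mulmx_block defA trmx0 tr_scalar_mx !mul0mx !mulmx0 !addr0.
rewrite [(r^-1 *: b)^T]linearZ /= !mul_scalar_mx mul_mx_scalar scale_scalar_mx rr !scalerA.
rewrite divff ?gt_eqF // !scale1r; congr block_mx.
rewrite -scalemxAl -scalemxAr scalerA -invfM rr.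
by rewrite -defS /S addrC subrK.
Qed.

(** With a Gram factorisation [A = Q^T Q] the trace is that of [Q S Q^T], whose
    diagonal entries are values of the form of [S].  Such a factorisation is at
    hand for positive definite matrices, whence the perturbation of [A] by a
    multiple of the identity. *)
Lemma tr_mul_psd_ge0 (R : rcfType) (n : nat) (A S : 'M[R]_n) :
  A^T = A -> (forall v, 0 <= qform A v) -> (forall v, 0 <= qform S v) ->
  0 <= \tr (A *m S).
Proof.
move=> symA psdA psdS; apply: (@ge0_of_small_perturbation _ _ (\tr S)) => e e0.
have [] := @posdef_gram _ _ (A + e%:M).
- by rewrite linearD /= symA tr_scalar_mx.
- move=> v v0; rewrite /qform mulmxDr mulmxDl mxE ltr_wpDl //; first exact: psdA.
  by rewrite mul_mx_scalar -scalemxAl mxE mulr_gt0 // sqr_norm_col_gt0.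
move=> Q _ defA.
have -> : \tr (A *m S) + e * \tr S = \tr (Q *m S *m Q^T).
  by rewrite -mxtraceZ -mul_scalar_mx -mxtraceD -mulmxDl defA -mulmxA mxtrace_mulC.
rewrite -{1}[Q]trmxK; apply: sumr_ge0 => i _.
by rewrite congr_mx_entry psdS.
Qed.

(** * The quadratic form of a sum of tensor products *)

(** The quadratic form of [\sum_c A_c (x) Y_c], with vectors of the tensor
    product encoded as [d x n] matrices; it is insensitive to the order of the
    two tensor factors. *)
Definition tensor_form (R : pzRingType) (I : finType) (d n : nat)
    (A : I -> 'M[R]_d) (Y : I -> 'M[R]_n) (W : 'M[R]_(d, n)) : R :=
  \sum_c \tr (W^T *m A c *m W *m (Y c)^T).

(** Compression of the coordinates moves to the test vector.  With [W] the
    identity this bounds the size of the families to be tested by [d]; with [V]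
    invertible it is the change of variables that normalises [Y_0]. *)
Lemma tensor_form_congr (R : comPzRingType) (I : finType) (d m n : nat)
    (A : I -> 'M[R]_d) (Y : I -> 'M[R]_n) (V : 'M[R]_(m, n)) (W : 'M[R]_(d, m)) :
  tensor_form A (fun c => V *m Y c *m V^T) W = tensor_form A Y (W *m V).
Proof.
apply: eq_bigr => c _; rewrite !trmx_mul trmxK !mulmxA.
by rewrite mxtrace_mulC !mulmxA.
Qed.

Lemma mulmx_entry (R : pzRingType) (m n p q : nat) (A : 'M[R]_(m, n))
    (B : 'M[R]_(n, p)) (C : 'M[R]_(p, q)) i j :
  (A *m B *m C) i j = \sum_a \sum_b A i a * B a b * C b j.
Proof.
rewrite mxE exchange_big /=; apply: eq_bigr => b _.
by rewrite mxE mulr_suml.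
Qed.

Lemma qform_sum_tens (R : comPzRingType) (I : finType) (d n : nat)
    (A : I -> 'M[R]_d) (Y : I -> 'M[R]_n) (v : 'cV[R]_(d * n)) :
  qform (\sum_c tensmx (A c) (Y c)) v =
  tensor_form A Y (\matrix_(a, p) v (mxtens_index (a, p)) 0).
Proof.
rewrite /qform mulmx_sumr mulmx_suml summxE; apply: eq_bigr => c _.
rewrite mulmx_entry.
have reidx (F : 'I_(d * n) -> R) :
    \sum_i F i = \sum_a \sum_p F (mxtens_index (a, p)).
  rewrite pair_big; apply: reindex => /=.
  by exists (@mxtens_unindex d n) => [[a p]|i] _;
    rewrite (mxtens_indexK, mxtens_unindexK).
rewrite reidx.
under eq_bigr => a _ do under eq_bigr => p _ do rewrite reidx.
under eq_bigr => a _ do under eq_bigr => p _ do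
  under eq_bigr => b _ do under eq_bigr => q _ do rewrite mxE tensmxE.
rewrite exchange_big; apply: eq_bigr => p _; rewrite mxE.
under [RHS]eq_bigr => q _ do rewrite mulmx_entry mxE mulr_suml.
rewrite [RHS]exchange_big; apply: eq_bigr => a _ /=.
under [RHS]eq_bigr => q _ do rewrite mulr_suml.
rewrite [RHS]exchange_big; apply: eq_bigr => b _ /=.
apply: eq_bigr => q _; rewrite !mxE -!mulrA; congr (_ * (_ * _)).
exact: mulrC.
Qed.

Lemma qform_mxblock (R : comPzRingType) (I : finType) (d n : nat)
    (A : I -> 'M[R]_d) (Y : I -> 'M[R]_n) (W : 'M[R]_(d, n)) :
  qform (\mxblock_(i < n, j < n) \sum_c Y c i j *: A c)
        (\mxcol_(i < n) col i W) = tensor_form A Y W.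
Proof.
rewrite /qform -mulmxA mul_mxblock_mxrow tr_mxcol mul_mxrow_mxcol summxE.
transitivity (\sum_i \sum_j \sum_c (W^T *m A c *m W) i j * Y c i j).
  apply: eq_bigr => i _; rewrite mulmx_sumr summxE; apply: eq_bigr => j _.
  rewrite mulmx_suml mulmx_sumr summxE; apply: eq_bigr => c _.
  by rewrite -scalemxAl -scalemxAr mxE mulrC mulmxA [in RHS]congr_mx_entry.
under eq_bigr do rewrite exchange_big.
rewrite exchange_big; apply: eq_bigr => c _; apply: eq_bigr => i _.
by rewrite mxE; apply: eq_bigr => j _; rewrite [(Y c)^T _ _]mxE.
Qed.

(** The symmetry type of the basis: it also characterises the coordinates of
    the symmetric matrices over the operator system. *)
Definition star_family (R : pzRingType) (g s n : nat)
    (Y : 'I_g -> 'M[R]_n) : Prop :=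
  forall c, (Y c)^T = if (c < s)%N then Y c else - Y c.

Lemma star_family_congr (R : comPzRingType) (g s m n : nat)
    (Y : 'I_g -> 'M[R]_n) (V : 'M[R]_(m, n)) :
  star_family s Y -> star_family s (fun c => V *m Y c *m V^T).
Proof.
move=> sY c; rewrite !trmx_mul trmxK sY mulmxA.
by case: ifP => _ //; rewrite mulmxN mulNmx.
Qed.

Lemma tr_sum_tens (R : comPzRingType) (g s d n : nat)
    (A : 'I_g -> 'M[R]_d) (Y : 'I_g -> 'M[R]_n) :
  star_family s A -> star_family s Y ->
  (\sum_c tensmx (A c) (Y c))^T = \sum_c tensmx (A c) (Y c).
Proof.
move=> sA sY; rewrite linear_sum; apply: eq_bigr => c _ /=.
rewrite trmx_tens sA sY; case: ifP => // _.
by apply/matrixP => i j; rewrite !mxE mulrNN.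
Qed.

(** * From unital families to arbitrary families *)

(** At a rank one [W = u v^T] the form of [A] and [Y] is the form of
    [S = \sum_c (v^T Y_c v) A_c] at [u], so [tr (A_0 S)] is nonnegative.  The
    terms with [c <> 0] in this trace vanish, by orthogonality when [A_c] is
    symmetric, and when it is skew-symmetric because then it is orthogonal to
    the symmetric matrix [A_0]. *)
Lemma leading_coef_psd (R : rcfType) (nu g s k : nat)
    (A : 'I_g.+1 -> 'M[R]_nu) (Y : 'I_g.+1 -> 'M[R]_k)
    (s_gt0 : (0 < s)%N) (starA : star_family s A)
    (A0_neq0 : A ord0 != 0) (A0_psd : forall v, 0 <= qform (A ord0) v)
    (A_orth : forall i j : 'I_g.+1, (i < s)%N -> (j < s)%N -> i != j ->
       \tr ((A i)^T *m A j) = 0) :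
  star_family s Y -> (forall W, 0 <= tensor_form A Y W) ->
  forall v, 0 <= qform (Y ord0) v.
Proof.
move=> starY posY v; pose S := \sum_c qform (Y c) v *: A c.
have symA0 : (A ord0)^T = A ord0 by rewrite starA s_gt0.
have S_ge0 u : 0 <= qform S u.
  have := posY (u *m v^T); congr (0 <= _).
  rewrite /qform /S mulmx_sumr mulmx_suml summxE; apply: eq_bigr => c _.
  rewrite -scalemxAr -scalemxAl mxE trmx_mul trmxK.
  have -> : v *m u^T *m A c *m (u *m v^T) = v *m (u^T *m A c *m u) *m v^T.
    by rewrite !mulmxA.
  rewrite {1}[u^T *m _ *m u]mx11_scalar mul_mx_scalar -!scalemxAl mxtraceZ mulrC.
  congr (_ * _); rewrite mxtrace_mulC mulmxA -mxtrace_tr !trmx_mul trmxK.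
  by rewrite !trmxK mxtrace_mulC /mxtrace big_ord1.
have := tr_mul_psd_ge0 symA0 A0_psd S_ge0.
rewrite /S mulmx_sumr linear_sum (bigD1 ord0) //= big1 ?addr0 => [|c c0].
  rewrite -scalemxAr mxtraceZ -{1}symA0.
  by rewrite pmulr_lge0 // sqr_norm_mx_gt0.
rewrite -scalemxAr mxtraceZ; case: (ltnP c s) => cs.
  by rewrite -{1}symA0 A_orth ?mulr0 // eq_sym.
have : \tr (A ord0 *m A c) == 0.
  rewrite -eqNr -{2}[A ord0 *m A c]trmxK mxtrace_tr trmx_mul symA0 starA.
  by rewrite ltnNge cs mulNmx linearN /= mxtrace_mulC.
by move/eqP ->; rewrite mulr0.
Qed.

(** A unital family is reached from [Y] in three moves, each of which preserves
    nonnegativity over [A]: the compression [Z] along the test vector has size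
    [l], the perturbation [Ze] has a positive definite leading coefficient, and
    the congruence [U] makes that coefficient the identity. *)
Lemma tensor_form_nonneg_of_unital (R : rcfType) (nu l g s : nat)
    (A : 'I_g.+1 -> 'M[R]_nu) (B : 'I_g.+1 -> 'M[R]_l)
    (s_gt0 : (0 < s)%N) (starA : star_family s A)
    (A0_neq0 : A ord0 != 0) (A0_psd : forall v, 0 <= qform (A ord0) v)
    (A_orth : forall i j : 'I_g.+1, (i < s)%N -> (j < s)%N -> i != j ->
       \tr ((A i)^T *m A j) = 0) :
  (forall Z : 'I_g.+1 -> 'M[R]_l, star_family s Z -> Z ord0 = 1%:M ->
     (forall W, 0 <= tensor_form A Z W) -> forall W, 0 <= tensor_form B Z W) ->
  forall (k : nat) (Y : 'I_g.+1 -> 'M[R]_k), star_family s Y ->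
    (forall W, 0 <= tensor_form A Y W) -> forall W, 0 <= tensor_form B Y W.
Proof.
move=> unitalB k Y starY posY W0.
pose Z c := W0 *m Y c *m W0^T.
have starZ : star_family s Z by exact: star_family_congr.
have posZ W : 0 <= tensor_form A Z W by rewrite tensor_form_congr.
rewrite -[W0]mul1mx -(tensor_form_congr B Y W0 1%:M) -/Z.
apply: (@ge0_of_small_perturbation _ _ (\tr (B ord0))) => e e0.
pose Ze c := Z c + if c == ord0 then e%:M else 0.
have formZe d (D : 'I_g.+1 -> 'M[R]_d) W :
    tensor_form D Ze W = tensor_form D Z W + e * \tr (W^T *m D ord0 *m W).
  rewrite /tensor_form (bigD1 ord0) //= [in RHS](bigD1 ord0) //= addrAC.
  congr (_ + _); first by
    rewrite /Ze eqxx linearD /= mulmxDr mxtraceD tr_scalar_mx mul_mx_scalar mxtraceZ.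
  by apply: eq_bigr => c /negbTE c0; rewrite /Ze c0 addr0.
have starZe : star_family s Ze.
  move=> c; rewrite /Ze; case: eqP => [->|_]; last by rewrite addr0 starZ.
  by rewrite linearD /= starZ s_gt0 tr_scalar_mx.
have posZe W : 0 <= tensor_form A Ze W.
  rewrite formZe addr_ge0 // mulr_ge0 ?(ltW e0) //.
  by apply: sumr_ge0 => i _; rewrite congr_mx_entry A0_psd.
have [||Q Qu defZe0] := @posdef_gram _ _ (Ze ord0).
- by rewrite starZe s_gt0.
- move=> v v0; rewrite /Ze eqxx /qform mulmxDr mulmxDl mxE ltr_wpDl //.
    exact: (leading_coef_psd s_gt0 starA).
  by rewrite mul_mx_scalar -scalemxAl mxE mulr_gt0 // sqr_norm_col_gt0.
pose U c := (invmx Q)^T *m Ze c *m (invmx Q)^T^T.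
have QV : Q^T *m (invmx Q)^T = 1%:M by rewrite -trmx_mul mulVmx // trmx1.
have posU := unitalB U (star_family_congr _ starZe).
(* The test vector [Q^T] for [U] is the test vector [1] for [Ze]. *)
have := posU _ _ Q^T; rewrite tensor_form_congr QV formZe trmx1 mul1mx mulmx1.
apply.
  rewrite /U defZe0 trmxK !mulmxA -[_ *m Q *m _]mulmxA mulmxV // mulmx1.
  by rewrite -trmx_mul mulmxV // trmx1.
by move=> W; rewrite tensor_form_congr.
Qed.
(** * Pencils and block matrices *)

Lemma psd_sum_tens (R : realType) (g s d n : nat)
    (A : 'I_g -> 'M[R]_d) (Y : 'I_g -> 'M[R]_n) :
  star_family s A -> star_family s Y ->
  psd (\sum_c tensmx (A c) (Y c)) <-> forall W, 0 <= tensor_form A Y W.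
Proof.
move=> starA starY; split=> [[_ posAY] W | posAY].
  have := posAY (\col_i W (mxtens_unindex i).1 (mxtens_unindex i).2).
  rewrite -/(qform _ _) qform_sum_tens; congr (0 <= tensor_form A Y _).
  by apply/matrixP => a p; rewrite !mxE mxtens_indexK.
split; first exact: (tr_sum_tens starA).
by move=> v; rewrite -/(qform _ _) qform_sum_tens.
Qed.

Lemma psd_mxblock_sum (R : realType) (g s d n : nat)
    (A : 'I_g -> 'M[R]_d) (Y : 'I_g -> 'M[R]_n) :
  star_family s A -> star_family s Y ->
  psd (\mxblock_(i < n, j < n) \sum_c Y c i j *: A c) <->
  forall W, 0 <= tensor_form A Y W.
Proof.
move=> starA starY; split=> [[_ posAY] W | posAY].
  by rewrite -qform_mxblock; exact: posAY.
split; last first.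
  move=> v; rewrite -/(qform _ _) -[v]submxcolK.
  set w := submxcol v.
  have := posAY (\matrix_(a, i) w i a 0); rewrite -qform_mxblock.
  congr (0 <= qform _ _); apply: eq_mxcol => i.
  by apply/matrixP => a j; rewrite !ord1 [LHS]mxE [LHS]mxE.
rewrite tr_mxblock; apply: eq_mxblock => i j; rewrite linear_sum.
apply: eq_bigr => c _; rewrite linearZ /= starA.
have -> : Y c j i = (Y c)^T i j by rewrite mxE.
by rewrite starY; case: ifP => // _; rewrite mxE scaleNr scalerN opprK.
Qed.

(** The coordinates in the basis [A] of the value of the pencil at [X]. *)
Definition pencil_point (R : pzRingType) (g s n : nat) (X : 'I_g -> 'M[R]_n)
    (c : 'I_g.+1) : 'M[R]_n :=
  if unlift ord0 c is Some i then
    if (c < s)%N then X i + (X i)^T else X i - (X i)^T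
  else 1%:M.

Lemma pencil_point0 (R : pzRingType) (g s n : nat) (X : 'I_g -> 'M[R]_n) :
  pencil_point s X ord0 = 1%:M.
Proof. by rewrite /pencil_point unlift_none. Qed.

Lemma star_pencil_point (R : pzRingType) (g s n : nat) (X : 'I_g -> 'M[R]_n) :
  (0 < s)%N -> star_family s (pencil_point s X).
Proof.
move=> s_gt0 c; rewrite /pencil_point; case: unliftP => [i ->|->].
  case: ifP => _; first by rewrite linearD /= trmxK addrC.
  by rewrite linearB /= trmxK opprB.
by rewrite s_gt0 tr_scalar_mx.
Qed.

(** Every family with leading coefficient [1] is the image of a point: half of
    a symmetric, or of a skew-symmetric, matrix recovers it in
    [X + X^T], or in [X - X^T]. *)
Lemma pencil_point_surj (R : realFieldType) (g s n : nat)
    (Z : 'I_g.+1 -> 'M[R]_n) :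
  star_family s Z -> Z ord0 = 1%:M ->
  pencil_point s (fun i => 2^-1 *: Z (lift ord0 i)) =1 Z.
Proof.
move=> starZ Z0 c; rewrite /pencil_point; case: unliftP => [i ->|->] //.
rewrite linearZ /= starZ; case: (_ < s)%N.
  by rewrite -scalerDl -div1r -splitr scale1r.
by rewrite scalerN opprK -scalerDl -div1r -splitr scale1r.
Qed.

Lemma peval_system_pencil (R : realType) (d g s n : nat)
    (A : 'I_g.+1 -> 'M[R]_d) (X : 'I_g -> 'M[R]_n) :
  peval (system_pencil s A) X = \sum_c tensmx (A c) (pencil_point s X c).
Proof.
rewrite /peval big_ord_recl pencil_point0; congr (_ + _).
apply: eq_bigr => i _; rewrite /pencil_point liftK /=.
apply/matrixP => a b; rewrite !mxE; case: ifP => _.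
  by rewrite !mxE mulrDr.
by rewrite !mxE mulrDr mulrN mulNr.
Qed.

Lemma free_spectrahedronP (R : realType) (d g s n : nat)
    (A : 'I_g.+1 -> 'M[R]_d) (X : 'I_g -> 'M[R]_n) :
  (0 < s)%N -> star_family s A ->
  free_spectrahedron (system_pencil s A) n X <->
  forall W, 0 <= tensor_form A (pencil_point s X) W.
Proof.
move=> s_gt0 starA; rewrite /free_spectrahedron /= peval_system_pencil.
by apply: (psd_sum_tens starA); exact: star_pencil_point.
Qed.

Lemma blocks_sum (R : realType) (I : finType) (m n : nat)
    (S : {vspace 'M[R]_m}) (x : I -> subvs_of S) (Y : I -> 'M[R]_n) :
  blocks (\matrix_(i, j) \sum_c Y c i j *: x c) =
  \mxblock_(i < n, j < n) \sum_c Y c i j *: vsval (x c).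
Proof.
apply: eq_mxblock => i j; rewrite mxE linear_sum; apply: eq_bigr => c _.
by rewrite linearZ.
Qed.

(** Transposing the expansion of [u] yields an expansion of [v] in the same
    basis, and coordinates are unique. *)
Lemma coord_star (R : realType) (m g s : nat) (S : {vspace 'M[R]_m})
    (A : g.-tuple (subvs_of S)) (c : 'I_g) (u v : subvs_of S) :
  basis_of fullv A -> star_family s (fun i => vsval (tnth A i)) ->
  vsval v = (vsval u)^T ->
  coord A c v = if (c < s)%N then coord A c u else - coord A c u.
Proof.
move=> A_basis starA vE.
pose k (i : 'I_g) := if (i < s)%N then coord A i u else - coord A i u.
suff -> : v = \sum_i k i *: A`_i by rewrite coord_sum_free ?(basis_free A_basis).
apply: val_inj; rewrite /= vE {1}(coord_basis A_basis (memvf u)).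
rewrite !linear_sum; apply: eq_bigr => i _ /=.
rewrite !linearZ /= -tnth_nth starA /k.
by case: ifP => // _; rewrite scalerN scaleNr.
Qed.

(** * The equivalence *)

Theorem theorem8p7 (R : realType) (nu l : nat)
    (AA : {vspace 'M[R]_nu}) (BB : {vspace 'M[R]_l})
    (opAA : operator_system AA) (opBB : operator_system BB)
    (tau : {linear subvs_of AA -> subvs_of BB})
    (tau_star : star_map tau)
    (AA_psd : psd_part AA <> [set 0])
    (g s : nat) (s_gt0 : (0 < s)%N) (s_le : (s <= g.+1)%N)
    (A : (g.+1).-tuple (subvs_of AA))
    (A_basis : basis_of fullv A)
    (A_sym : forall i : 'I_g.+1, (i < s)%N ->
       (vsval (tnth A i))^T = vsval (tnth A i))
    (A_skew : forall i : 'I_g.+1, (s <= i)%N ->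
       (vsval (tnth A i))^T = - vsval (tnth A i))
    (A0_neq0 : vsval (tnth A ord0) <> 0)
    (A0_psd : psd (vsval (tnth A ord0)))
    (A0_max : forall Y : 'M[R]_nu, psd_part AA Y ->
       (\rank Y <= \rank (vsval (tnth A ord0)))%N)
    (A_orth : forall i j : 'I_g.+1, (i < s)%N -> (j < s)%N -> i != j ->
       \tr ((vsval (tnth A i))^T *m vsval (tnth A j)) = 0) :
  let LA := system_pencil s (fun i => vsval (tnth A i)) in
  let LB := system_pencil s (fun i => vsval (tau (tnth A i))) in
  (completely_positive tau <->
     (forall n : nat,
        free_spectrahedron LA n `<=` free_spectrahedron LB n))
  /\
  ((forall n : nat,
        free_spectrahedron LA n `<=` free_spectrahedron LB n)
   <->
   free_spectrahedron LA l `<=` free_spectrahedron LB l).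
Proof.
move=> LA LB.
pose a c := vsval (tnth A c); pose b c := vsval (tau (tnth A c)).
have star_a : star_family s a.
  by move=> c; case: ltnP => cs; [exact: A_sym | exact: A_skew].
have star_b : star_family s b.
  move=> c; rewrite /b; case: ltnP => cs.
    by apply/esym/tau_star; rewrite A_sym.
  rewrite -linearN -linearN; apply/esym/tau_star.
  by rewrite A_skew // linearN.
have tau_blocks n (Y : 'I_g.+1 -> 'M[R]_n) :
    blocks (map_mx tau (\matrix_(i, j) \sum_c Y c i j *: tnth A c)) =
    \mxblock_(i < n, j < n) \sum_c Y c i j *: b c.
  rewrite -blocks_sum; congr blocks; apply/matrixP => i j.
  by rewrite !mxE linear_sum; apply: eq_bigr => c _; rewrite linearZ.
have cp_incl n : completely_positive tau ->
    free_spectrahedron LA n `<=` free_spectrahedron LB n.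
  move=> cp X /(free_spectrahedronP _ s_gt0 star_a) posX.
  have starX := star_pencil_point X s_gt0.
  apply/(free_spectrahedronP _ s_gt0 star_b)/(psd_mxblock_sum star_b starX).
  rewrite -tau_blocks; apply: cp; rewrite blocks_sum.
  exact/(psd_mxblock_sum star_a starX).
have incl_cp : free_spectrahedron LA l `<=` free_spectrahedron LB l ->
    completely_positive tau.
  move=> incl k M [symM posM].
  pose Y c := \matrix_(i, j) coord A c (M i j).
  have defM : M = \matrix_(i, j) \sum_c Y c i j *: tnth A c.
    apply/matrixP => i j; rewrite mxE {1}(coord_basis A_basis (memvf (M i j))).
    by apply: eq_bigr => c _; rewrite mxE -tnth_nth.
  have starY : star_family s Y.
    move=> c; apply/matrixP => i j; rewrite mxE mxE.
    move: symM; rewrite /blocks tr_mxblock => /eq_mxblockP/(_ j i) symM.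
    rewrite (coord_star c A_basis star_a (esym symM)).
    by case: ifP => _; rewrite !mxE.
  have posY W : 0 <= tensor_form a Y W.
    by move: W; apply/(psd_mxblock_sum star_a starY); rewrite -blocks_sum -defM.
  rewrite defM tau_blocks; apply/(psd_mxblock_sum star_b starY) => W.
  have A0_neq : a ord0 != 0 by apply/eqP.
  have [_ A0_pos] := A0_psd.
  apply: (tensor_form_nonneg_of_unital s_gt0 star_a A0_neq A0_pos A_orth _ starY).
    move=> Z starZ Z0 posZ.
    have formZ d (D : 'I_g.+1 -> 'M[R]_d) V : tensor_form D Z V =
        tensor_form D (pencil_point s (fun i => 2^-1 *: Z (lift ord0 i))) V.
      by apply: eq_bigr => c _; rewrite (pencil_point_surj starZ Z0).
    move=> V; rewrite formZ; move: V.
    apply/(free_spectrahedronP _ s_gt0 star_b); apply: incl.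
    apply/(free_spectrahedronP _ s_gt0 star_a) => V; rewrite -formZ; exact: posZ.
  exact: posY.
split; split.
- by move=> cp n; exact: cp_incl.
- by move=> incl; exact: incl_cp.
- by move=> incl; exact: incl.
- by move=> incl n; exact: cp_incl (incl_cp incl).
Qed.
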